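(* (Isomorphism Theorem) Let $A\subseteq\omega$ be an infinite c.e. set. Any two quasi-Gödel numberings $\theta,\theta'$ of $\mathcal S^{(1)}_A$ are computably isomorphic, i.e. there is a computable bijection $g:\omega\to\omega$ with $\theta_i=\theta'_{g(i)}$ for all $i\in\omega$.
   Context: $\omega$ is the set of natural numbers; $\mathcal R^{(n)}$ is the set of total computable functions $\omega^n\to\omega$. $\langle\cdot,\cdot\rangle:\omega^2\to\omega$ is a computable bijection with $\langle x,y\rangle\ge x,y$. $\mathrm{Anf}^{(1)}_A$ is the set of partial functions from $\omega$ to $\omega$ whose domain is either empty or equal to $\{0,\dots,a-1\}$ for some $a\in A$, and $\mathcal S^{(1)}_A=\mathcal R^{(1)}\cup\mathrm{Anf}^{(1)}_A$. The extended graph of a unary partial function $q$ is $\{\langle y,0\rangle:y\in\omega\}\cup\{\langle x,q(x)+1\rangle:x\in\mathrm{dom}(q)\}$; that of a binary partial function $q$ is $\{\langle\langle y,y'\rangle,0\rangle:y,y'\in\omega\}\cup\{\langle\langle x,x'\rangle,q(x,x')+1\rangle:(x,x')\in\mathrm{dom}(q)\}$. A numbering of a set $X$ is a surjection $\omega\to X$. A numbering $\theta$ of $\mathcal S^{(1)}_A$ is a quasi-Gödel numbering if: (QGN I) the extended graph of $(i,x)\mapsto\theta_i(x)$ is the range of a function in $\mathcal R^{(1)}$; and (QGN II) for every $k\in\mathcal R^{(2)}$ there is $v\in\mathcal R^{(1)}$ such that for all $i\in\omega$, $r\in\mathcal S^{(1)}_A$: if $\{k(i,t):t\in\omega\}$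 is the extended graph of $r$, then $r=\theta_{v(i)}$. *)

(* Defs.v *)
From mathcomp Require Import all_boot.
From mathcomp Require Import boolp classical_sets functions cardinality.

Set Implicit Arguments.
Unset Strict Implicit.
Unset Printing Implicit Defensive.

Local Open Scope classical_set_scope.

(* Kleene's mu-recursive schemes; [mu_code n] codes n-ary partial functions. *)
Inductive mu_code : nat -> Type :=
| MuZero : mu_code 0
| MuSucc : mu_code 1
| MuProj n (i : 'I_n) : mu_code n
| MuComp m n (f : mu_code m) (g : 'I_m -> mu_code n) : mu_code n
| MuRec n (f : mu_code n) (g : mu_code n.+2) : mu_code n.+1
| MuMin n (f : mu_code n.+1) : mu_code n.

(* [mu_eval c v y]: the partial function coded by [c] is defined at [v], with
   value [y].  In [MuRec f g] the first argument is the recursion variable: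
   h(0, v) = f(v) and h(k+1, v) = g(k, h(k, v), v).  In [MuMin f] the search
   is over the first argument of [f], and [f] has to be defined at all the
   arguments below the zero found. *)
Fixpoint mu_eval n (c : mu_code n) : n.-tuple nat -> nat -> Prop :=
  match c in mu_code n return n.-tuple nat -> nat -> Prop with
  | MuZero => fun _ y => y = 0
  | MuSucc => fun v y => y = (thead v).+1
  | MuProj _ i => fun v y => y = tnth v i
  | MuComp m _ f g => fun v y =>
      exists w : m.-tuple nat,
        (forall i, mu_eval (g i) v (tnth w i)) /\ mu_eval f w y
  | MuRec n f g => fun v =>
      let u : n.-tuple nat := [tuple of behead v] in
      (fix rec k : nat -> Prop :=
         if k is k'.+1 then
           fun y => exists z, rec k' z /\ mu_eval g [tuple of k' :: z :: u] y
         else mu_eval f u) (thead v)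
  | MuMin _ f => fun v y =>
      mu_eval f [tuple of y :: v] 0 /\
      forall k, k < y -> exists z, mu_eval f [tuple of k :: v] z.+1
  end.

Definition computable n (f : n.-tuple nat -> nat) : Prop :=
  exists c : mu_code n, forall v y, mu_eval c v y <-> f v = y.

Definition computable1 : set (nat -> nat) :=
  [set f | computable (fun v : 1.-tuple nat => f (thead v))].

Definition computable2 : set (nat -> nat -> nat) :=
  [set f | computable (fun v : 2.-tuple nat => f (tnth v ord0) (tnth v ord_max))].

Definition computably_enumerable (A : set nat) : Prop :=
  A = set0 \/ exists2 f, computable1 f & range f = A.

Definition pairing (pr : nat -> nat -> nat) : Prop :=
  [/\ computable2 pr,
      bijective (fun p : nat * nat => pr p.1 p.2) &
      forall x y, x <= pr x y /\ y <= pr x y].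

(* A partial function is undefined where its value is [None]. *)
Definition pfun1 := nat -> option nat.
Definition pfun2 := nat -> nat -> option nat.

Definition pdom (q : pfun1) : set nat := [set x | q x <> None].

Definition ext_graph1 (pr : nat -> nat -> nat) (q : pfun1) : set nat :=
  [set n | exists y, n = pr y 0] `|`
  [set n | exists x z, q x = Some z /\ n = pr x z.+1].

Definition ext_graph2 (pr : nat -> nat -> nat) (q : pfun2) : set nat :=
  [set n | exists y y', n = pr (pr y y') 0] `|`
  [set n | exists x x' z, q x x' = Some z /\ n = pr (pr x x') z.+1].

(* [`I_a] is the initial segment of the naturals below [a]. *)
Definition Anf1 (A : set nat) : set pfun1 :=
  [set q | pdom q = set0 \/ exists2 a, A a & pdom q = `I_a].

Definition S1 (A : set nat) : set pfun1 :=
  [set q | exists2 f, computable1 f & q = (fun x => Some (f x))] `|` Anf1 A.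

Definition numbering (T : Type) (X : set T) (theta : nat -> T) : Prop :=
  range theta = X.

Definition QGN_I (pr : nat -> nat -> nat) (theta : nat -> pfun1) : Prop :=
  exists2 e, computable1 e & range e = ext_graph2 pr (fun i x => theta i x).

Definition QGN_II (pr : nat -> nat -> nat) (A : set nat)
    (theta : nat -> pfun1) : Prop :=
  forall k, computable2 k ->
  exists2 v, computable1 v &
    forall i r, S1 A r -> range (k i) = ext_graph1 pr r -> r = theta (v i).

Definition quasi_Godel_numbering (pr : nat -> nat -> nat) (A : set nat)
    (theta : nat -> pfun1) : Prop :=
  [/\ numbering (S1 A) theta, QGN_I pr theta & QGN_II pr A theta].

(* Main.v *)
Require Import Defs.
From mathcomp Require Import all_boot.
From mathcomp Require Import boolp classical_sets functions cardinality.

(* Two numberings are related by a back-and-forth construction, which needs, for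
   an index i of one numbering and a finite set D, an index n of the same
   function in the other one with n outside D.  By the recursion theorem there
   is, for each c, an index n_c computed from i, D, c such that the function
   numbered n_c is the constant c if n_c is in D, and the function numbered i
   otherwise.  If all the n_c were in D, they would be pairwise distinct, since
   they number distinct constants; as D is finite, some n_c is outside D and
   hence numbers the required function.
   The recursion theorem holds although the numbered functions are restricted:
   QGN II turns enumerations K(q, t), with q = <x, p>, into a total computable
   v with v(q) an index of the function enumerated by K(q, _); v is itself
   numbered by some a, so K can recover v(<a, p>) from the index a and hence may
   refer to its own output. *)

Set Implicit Arguments.
Unset Strict Implicit.
Unset Printing Implicit Defensive.

Local Open Scope classical_set_scope.

(** * Closure properties of the computable functions *)

(** Componentwise computability is what [MuComp] asks of its inner functions. *)
Definition computable_subst m n (s : n.-tuple nat -> m.-tuple nat) : Prop :=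
  forall i, computable (fun v => tnth (s v) i).

Lemma computable_proj n (i : 'I_n) : computable (fun v : n.-tuple nat => tnth v i).
Proof. by exists (MuProj i) => v y; split => [->|<-]. Qed.

Lemma computable_comp m n (f : m.-tuple nat -> nat)
    (s : n.-tuple nat -> m.-tuple nat) :
  computable f -> computable_subst s -> computable (fun v => f (s v)).
Proof.
move=> [cf Hcf] /choice[cs Hcs]; exists (MuComp cf cs) => v y /=; split.
  move=> [w [Hw /Hcf <-]]; congr f; apply: eq_from_tnth => i.
  by apply/Hcs/Hw.
by move=> <-; exists (s v); split => [i|]; [apply/Hcs | apply/Hcf].
Qed.

Lemma computable_id_subst n : computable_subst (fun v : n.-tuple nat => v).
Proof. by move=> i; exact: computable_proj. Qed.

Lemma computable_behead_subst n m (s : n.-tuple nat -> m.+1.-tuple nat) :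
  computable_subst s -> computable_subst (fun v => [tuple of behead (s v)]).
Proof.
move=> Hs i; have := Hs (lift ord0 i); congr computable.
by apply/funext => v; rewrite [in LHS](tuple_eta (s v)) tnthS.
Qed.

Lemma computable_cons_subst n m (h : n.-tuple nat -> nat)
    (s : n.-tuple nat -> m.-tuple nat) :
  computable h -> computable_subst s ->
  computable_subst (fun v => [tuple of h v :: s v]).
Proof.
move=> Hh Hs i; case: (unliftP ord0 i) => [j|] ->.
  by have := Hs j; congr computable; apply/funext => v; rewrite tnthS.
by have := Hh; congr computable; apply/funext => v; rewrite tnth0.
Qed.

Lemma computable_nil_subst n (s : n.-tuple nat -> 0.-tuple nat) :
  computable_subst s.
Proof. by case. Qed.

Lemma computable_succ n (f : n.-tuple nat -> nat) :
  computable f -> computable (fun v => (f v).+1).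
Proof.
move=> Hf; apply: (@computable_comp 1 n (fun v => (thead v).+1)
  (fun v => [tuple f v])); first by exists MuSucc => v y; split => [->|<-].
by apply: computable_cons_subst => //; exact: computable_nil_subst.
Qed.

Lemma computable_const n (c : nat) : computable (fun _ : n.-tuple nat => c).
Proof.
elim: c => [|c IHc]; last exact: computable_succ.
apply: (@computable_comp 0 n (fun=> 0) (fun=> [tuple])).
  by exists MuZero => v y; split => [->|<-].
exact: computable_nil_subst.
Qed.

(** [MuRec] recurses on the first argument of a tuple, so the recursion is first coded with a
    separate counter, for which [h v] is then substituted. *)
Lemma computable_nat_rec n (f h : n.-tuple nat -> nat)
    (g : nat -> nat -> n.-tuple nat -> nat) :
  computable f -> computable h ->
  computable (fun w : n.+2.-tuple nat =>
    g (thead w) (thead [tuple of behead w])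
      [tuple of behead [tuple of behead w]]) ->
  computable (fun v => nat_rec (fun=> nat) (f v) (fun k r => g k r v) (h v)).
Proof.
move=> [cf Hcf] Hh [cg Hcg].
pose F (v : n.+1.-tuple nat) := nat_rec (fun=> nat) (f [tuple of behead v])
  (fun k r => g k r [tuple of behead v]) (thead v).
have HF : computable F.
  exists (MuRec cf cg) => v /=; rewrite /F.
  elim: (thead v) => [|k IHk] y /=; first exact: Hcf.
  split=> [[z [/IHk <- /Hcg <-]]|<-].
    by rewrite !theadE; congr g; apply/val_inj.
  eexists; split; first exact/IHk.
  by apply/Hcg; rewrite !theadE; congr g; apply/val_inj.
have := computable_comp HF (computable_cons_subst Hh (@computable_id_subst n)).
congr computable; apply/funext => v; rewrite /F theadE.
by have -> : [tuple of behead [tuple of h v :: v]] = v by exact/val_inj.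
Qed.

Lemma computable_tnth m n (s : n.-tuple nat -> m.-tuple nat) i :
  computable_subst s -> computable (fun v => tnth (s v) i).
Proof. exact. Qed.

Lemma computable_thead m n (s : n.-tuple nat -> m.+1.-tuple nat) :
  computable_subst s -> computable (fun v => thead (s v)).
Proof. exact. Qed.

Lemma computable_app1 (f : nat -> nat) n (a : n.-tuple nat -> nat) :
  computable1 f -> computable a -> computable (fun v => f (a v)).
Proof.
move=> Hf Ha; apply: (computable_comp (s := fun v => [tuple a v]) Hf).
by apply: computable_cons_subst => //; exact: computable_nil_subst.
Qed.

Lemma computable_app2 (f : nat -> nat -> nat) n (a b : n.-tuple nat -> nat) :
  computable2 f -> computable a -> computable b ->
  computable (fun v => f (a v) (b v)).
Proof.
move=> Hf Ha Hb.
have := computable_comp (s := fun v => [tuple a v; b v]) Hf.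
apply; apply: computable_cons_subst => //.
by apply: computable_cons_subst => //; exact: computable_nil_subst.
Qed.

(** A recursion over the truth value runs at most once: its base is [g] and its step returns [f]. *)
Lemma computable_if n (b : n.-tuple nat -> bool) (f g : n.-tuple nat -> nat) :
  computable (fun v => b v : nat) -> computable f -> computable g ->
  computable (fun v => if b v then f v else g v).
Proof.
move=> Hb Hf Hg.
have := @computable_nat_rec n g _ (fun _ _ v => f v) Hg Hb.
have -> : (fun v => nat_rec (fun=> nat) (g v) (fun _ _ => f v) (b v)) =
  fun v => if b v then f v else g v by apply/funext => v; case: (b v).
apply; apply: (computable_comp Hf).
do 2 apply: computable_behead_subst; exact: computable_id_subst.
Qed.

Lemma computable_negb n (b : n.-tuple nat -> bool) :
  computable (fun v => b v : nat) -> computable (fun v => ~~ b v : nat).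
Proof.
move=> Hb; have := computable_if Hb (computable_const _ 0) (computable_const _ 1).
by congr computable; apply/funext => v; case: (b v).
Qed.

Lemma computable_andb n (b c : n.-tuple nat -> bool) :
  computable (fun v => b v : nat) -> computable (fun v => c v : nat) ->
  computable (fun v => b v && c v : nat).
Proof.
move=> Hb Hc; have := computable_if Hb Hc (computable_const _ 0).
by congr computable; apply/funext => v; case: (b v).
Qed.

Lemma computable_orb n (b c : n.-tuple nat -> bool) :
  computable (fun v => b v : nat) -> computable (fun v => c v : nat) ->
  computable (fun v => b v || c v : nat).
Proof.
move=> Hb Hc; have := computable_if Hb (computable_const _ 1) Hc.
by congr computable; apply/funext => v; case: (b v).
Qed.

Lemma computable_pred n (f : n.-tuple nat -> nat) :
  computable f -> computable (fun v => (f v).-1).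
Proof.
move=> Hf.
have := @computable_nat_rec n _ f (fun k _ _ => k) (computable_const _ 0) Hf.
have -> : (fun v => nat_rec (fun=> nat) 0 (fun k _ => k) (f v)) =
  fun v => (f v).-1 by apply/funext => v; case: (f v).
by apply; apply/computable_thead/computable_id_subst.
Qed.

Lemma computable_subn n (f g : n.-tuple nat -> nat) :
  computable f -> computable g -> computable (fun v => f v - g v).
Proof.
move=> Hf Hg.
have := @computable_nat_rec n f g (fun _ r _ => r.-1) Hf Hg.
have -> : (fun v => nat_rec (fun=> nat) (f v) (fun _ r => r.-1) (g v)) =
  fun v => f v - g v.
  by apply/funext => v; elim: (g v) => [|k /= ->]; rewrite ?subn0 // subnS.
apply; apply/computable_pred/computable_thead/computable_behead_subst.
exact: computable_id_subst.
Qed.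

(** Equality means that both truncated differences vanish, and [1 - h v] is the truth value of
    [h v == 0]. *)
Lemma computable_eqn n (f g : n.-tuple nat -> nat) :
  computable f -> computable g -> computable (fun v => f v == g v : nat).
Proof.
have computable_eq0 (h : n.-tuple nat -> nat) : computable h ->
    computable (fun v => h v == 0 : nat).
  move=> Hh; have := computable_subn (computable_const n 1) Hh.
  by congr computable; apply/funext => v; case: (h v).
move=> Hf Hg; have := computable_andb (computable_eq0 _ (computable_subn Hf Hg))
  (computable_eq0 _ (computable_subn Hg Hf)).
congr computable; apply/funext => v.
by rewrite !subn_eq0 -eqn_leq.
Qed.

Lemma computable_has_iota n (b : nat -> n.-tuple nat -> bool)
    (h : n.-tuple nat -> nat) :
  computable (fun w : n.+1.-tuple nat =>
    b (thead w) [tuple of behead w] : nat) ->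
  computable h -> computable (fun v => has (b^~ v) (iota 0 (h v)) : nat).
Proof.
move=> Hb Hh.
have := @computable_nat_rec n _ h (fun k r v => (r != 0) || b k v)
  (computable_const _ 0) Hh.
have -> : (fun v => nat_rec (fun=> nat) 0
    (fun k r => (r != 0) || b k v : nat) (h v)) =
  fun v => has (b^~ v) (iota 0 (h v)) : nat.
  apply/funext => v; elim: (h v) => [//|k IHk].
  by rewrite -[in RHS]addn1 iotaD has_cat /= IHk orbF; case: has.
have Hid := @computable_id_subst n.+2; apply; apply: computable_orb.
  apply/computable_negb/computable_eqn; last exact: computable_const.
  exact/computable_thead/computable_behead_subst.
have Hs : computable_subst (fun w : n.+2.-tuple nat =>
    [tuple of thead w :: [tuple of behead [tuple of behead w]]]).
  apply: computable_cons_subst; first exact/computable_thead.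
  by do 2 apply: computable_behead_subst.
have := computable_comp Hb Hs; congr computable; apply/funext => w.
by congr (nat_of_bool (b _ _)); exact/val_inj.
Qed.

(** [MuMin] looks for a zero, so it is applied to the negation of [b]; the function found is the
    least witness. *)
Lemma computable_search n (b : nat -> n.-tuple nat -> bool) :
  computable (fun w : n.+1.-tuple nat =>
    b (thead w) [tuple of behead w] : nat) ->
  (forall v, exists k, b k v) ->
  exists2 g : n.-tuple nat -> nat, computable g & forall v, b (g v) v.
Proof.
move=> /computable_negb[c Hc] ex_b.
pose g v := ex_minn (ex_b v); exists g; last by rewrite /g => v; case: ex_minnP.
have bE (v : n.-tuple nat) (k z : nat) : mu_eval c [tuple of k :: v] z <-> ~~ b k v = z :> nat.
  have -> : b k v = b (thead [tuple of k :: v])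
    [tuple of behead [tuple of k :: v]] by congr b; apply/val_inj.
  exact: Hc.
exists (MuMin c) => v y /=; rewrite /g; case: ex_minnP => m bm mP.
split=> [[/bE b0 bS]|<-].
  apply/eqP; rewrite eqn_leq mP /=; last by case: (b y v) b0.
  by rewrite leqNgt; apply/negP => /bS[z /bE]; rewrite bm.
split=> [|k ltkm]; first by apply/bE; rewrite bm.
exists 0; apply/bE; case bk: (b k v) => //.
by have := mP _ bk; rewrite leqNgt ltkm.
Qed.

Ltac solve_subst :=
  repeat first [exact: computable_id_subst | apply: computable_behead_subst].

Ltac solve_computable :=
  repeat lazymatch goal with
  | |- computable (fun _ => nat_of_bool (~~ _)) => apply: computable_negb
  | |- computable (fun _ => nat_of_bool (_ && _)) => apply: computable_andb
  | |- computable (fun _ => nat_of_bool (_ || _)) => apply: computable_orb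
  | |- computable (fun _ => nat_of_bool (_ == _)) => apply: computable_eqn
  | |- computable (fun _ => nat_of_bool (has _ (iota 0 _))) =>
      apply: computable_has_iota
  | |- computable (fun _ => if _ then _ else _) => apply: computable_if
  | |- computable (fun _ => nat_rec _ _ _ _) => apply: computable_nat_rec
  | |- computable (@thead _ _) => exact: (computable_proj (@ord0 _))
  | |- computable (fun _ => thead _) => apply: computable_thead; solve_subst
  | |- computable (fun _ => tnth _ _) => apply: computable_tnth; solve_subst
  | |- computable (fun _ => (_).+1) => apply: computable_succ
  | |- computable (fun _ => (_).-1) => apply: computable_pred
  | |- computable (fun _ => nat_of_bool (?b _ _)) =>
      match goal with H : computable2 (fun x y => nat_of_bool (b x y)) |- _ =>
        apply: (computable_app2 H) end
  | |- computable (fun _ => ?f _ _) =>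
      match goal with H : computable2 f |- _ => apply: (computable_app2 H) end
  | |- computable (fun _ => ?f _) =>
      match goal with H : computable1 f |- _ => apply: (computable_app1 H) end
  | |- computable (fun _ => _) => exact: computable_const
  end.

(** * Computable inverses of the pairing function *)

Definition unpairing (pr : nat -> nat -> nat) (p1 p2 : nat -> nat) : Prop :=
  [/\ computable1 p1, computable1 p2,
      forall x y, p1 (pr x y) = x, forall x y, p2 (pr x y) = y &
      forall z, pr (p1 z) (p2 z) = z].

(** Both coordinates of [z] are at most [z], so each can be searched for while the other one is
    quantified boundedly. *)
Lemma unpairing_exists pr : pairing pr -> exists p1 p2, unpairing pr p1 p2.
Proof.
move=> [Cpr [q qK Kq] pr_ge].
have qpr x y : q (pr x y) = (x, y) := qK (x, y).
have qE z : pr (q z).1 (q z).2 = z := Kq z.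
have q_le z : (q z).1 <= z /\ (q z).2 <= z.
  by have := pr_ge (q z).1 (q z).2; rewrite qE.
have [g1 Cg1 g1P] : exists2 g : 1.-tuple nat -> nat, computable g &
    forall v, has (fun y => pr (g v) y == thead v) (iota 0 (thead v).+1).
  apply: (computable_search (b := fun x (v : 1.-tuple nat) =>
    has (fun y => pr x y == thead v) (iota 0 (thead v).+1))).
    by solve_computable.
  move=> v; exists (q (thead v)).1; apply/hasP; exists (q (thead v)).2.
    by rewrite mem_iota add0n ltnS; case: (q_le (thead v)).
  by rewrite qE.
have [g2 Cg2 g2P] : exists2 g : 1.-tuple nat -> nat, computable g &
    forall v, has (fun x => pr x (g v) == thead v) (iota 0 (thead v).+1).
  apply: (computable_search (b := fun y (v : 1.-tuple nat) =>
    has (fun x => pr x y == thead v) (iota 0 (thead v).+1))).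
    by solve_computable.
  move=> v; exists (q (thead v)).2; apply/hasP; exists (q (thead v)).1.
    by rewrite mem_iota add0n ltnS; case: (q_le (thead v)).
  by rewrite qE.
exists (fun z => (q z).1), (fun z => (q z).2).
split=> [||x y|x y|z]; rewrite ?qpr ?qE //.
  move: Cg1; congr computable; apply/funext => v.
  by have /hasP[y _ /eqP <-] := g1P v; rewrite qpr.
move: Cg2; congr computable; apply/funext => v.
by have /hasP[y _ /eqP <-] := g2P v; rewrite qpr.
Qed.

(** * The recursion theorem and indices outside a finite set *)

(** Pigeonhole: otherwise [b.+2] numbers would be mapped injectively into [b.+1] numbers. *)
Lemma unbounded_of_injective (f : nat -> nat) (b : nat) :
  injective f -> exists n, b < f n.
Proof.
move=> f_inj; apply: contrapT => /forallNP f_le.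
have f_lt (i : 'I_b.+2) : f i < b.+1 by rewrite ltnS leqNgt; apply/negP/f_le.
have := @leq_card _ _ (fun i => Ordinal (f_lt i)).
rewrite !card_ord ltnn => H; suff: false by [].
by apply: H => i j /(congr1 val) /f_inj /val_inj.
Qed.

(** Pairs [pr y 0] lie in every extended graph, so the enumeration can list them while it waits for
    its own index and remain total. A stage [t] codes two independent ones: [p2 t] for finding the
    index, [p1 t] for listing the graph. *)
Lemma self_referential_index (pr : nat -> nat -> nat) (A : set nat)
    (theta theta' : nat -> pfun1) (inD : nat -> nat -> bool) :
  pairing pr -> quasi_Godel_numbering pr A theta ->
  quasi_Godel_numbering pr A theta' ->
  computable2 (fun n l => inD n l : nat) ->
  exists2 N : nat -> nat, computable1 N &
    forall i l c, let n := N (pr i (pr l c)) in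
      theta' n = if inD n l then (fun=> Some c) else theta i.
Proof.
move=> Hpr [theta_S1 [e Ce eE] _] [theta'_S1 [e' Ce' e'E] QGN2] CD.
have [p1 [p2 [Cp1 Cp2 p1E p2E prE]]] := unpairing_exists Hpr.
have Cpr : computable2 pr by case: Hpr.
(* [K q t], for q = <x, <i, <l, c>>>: at stage p2 t, look for the value n of
   theta'_x at q, and then list the graph chosen according to [inD n l]. *)
pose K q t :=
  if (p1 (e' (p2 t)) == pr (p1 q) q) && (p2 (e' (p2 t)) != 0) then
    if inD (p2 (e' (p2 t))).-1 (p1 (p2 (p2 q))) then
      pr (p1 t) (p2 (p2 (p2 q))).+1
    else if p1 (p1 (e (p1 t))) == p1 (p2 q) then
      pr (p2 (p1 (e (p1 t)))) (p2 (e (p1 t)))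
    else pr 0 0
  else pr (p1 t) 0.
have CK : computable2 K by rewrite /computable2 /= /K; solve_computable.
have [v Cv vE] := QGN2 K CK.
have [a _ aE] : range theta' (fun x => Some (v x)).
  by rewrite theta'_S1; left; exists v.
exists (fun p => v (pr a p)).
  rewrite /computable1 /=; solve_computable.
move=> i l c; set q := pr a _; set n := v q; cbv zeta.
(* Stage [s0] tells nothing about [theta' a], stage [s1] reveals its value [n] at [q]; they serve to
   list the pairs [pr y 0] and the pairs of the chosen function, respectively. *)
have [s0 Es0] : exists s, e' s = pr (pr 0 0) 0.
  have : range e' (pr (pr 0 0) 0) by rewrite e'E; left; exists 0, 0.
  by case=> s _; exists s.
have [s1 Es1] : exists s, e' s = pr (pr a q) n.+1.
  have : range e' (pr (pr a q) n.+1).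
    by rewrite e'E; right; exists a, q, n; split => //; rewrite aE.
  by case=> s _; exists s.
have e'n s : p1 (e' s) = pr a q -> p2 (e' s) != 0 -> p2 (e' s) = n.+1.
  have : range e' (e' s) by exists s.
  rewrite e'E => -[[y [y' ->]]|[x [x' [z [Ez ->]]]]]; rewrite p1E p2E //.
  move=> Exx _; have := congr1 p1 Exx; have := congr1 p2 Exx.
  by rewrite !p1E !p2E => ? ?; subst x x'; move: Ez; rewrite aE => -[<-].
have Kq t : K q t = if (p1 (e' (p2 t)) == pr a q) && (p2 (e' (p2 t)) != 0) then
    if inD n l then pr (p1 t) c.+1
    else if p1 (p1 (e (p1 t))) == i then
      pr (p2 (p1 (e (p1 t)))) (p2 (e (p1 t)))
    else pr 0 0
  else pr (p1 t) 0.
  rewrite /K /q !(p1E, p2E) -/q; case: ifP => // /andP[/eqP E1 E2].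
  by rewrite (e'n _ E1 E2).
(* QGN II speaks of members of [S1 A] only: a constant is total computable, and [theta i] is a
   member since [theta] is a numbering. *)
symmetry; apply: vE.
  case: ifP => _; last by rewrite -theta_S1; exists i.
  left; exists (fun=> c) => //; exact: computable_const.
apply/seteqP; split => [_ [t _ <-]|].
  rewrite Kq; case: (_ && _); last by left; exists (p1 t).
  case: (inD n l); first by right; exists (p1 t), c.
  case: eqP => [Ei|_]; last by left; exists 0.
  have : range e (e (p1 t)) by exists (p1 t).
  rewrite eE => -[[y [y' E]]|[x [x' [z [Ez E]]]]]; move: Ei; rewrite E !(p1E, p2E).
    by left; exists y'.
  by move=> <-; right; exists x', z.
move=> _ [[y ->]|[x [z [Ez ->]]]].
  by exists (pr y s0) => //; rewrite Kq p2E Es0 p2E andbF p1E.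
case: ifP Ez => Dn Ez.
  exists (pr x s1) => //; rewrite Kq p2E Es1 p1E p2E eqxx /= Dn p1E.
  by case: Ez => ->.
have [u _ Eu] : range e (pr (pr i x) z.+1).
  by rewrite eE; right; exists i, x, z.
exists (pr u s1) => //.
by rewrite Kq p2E Es1 p1E p2E eqxx /= Dn p1E Eu !(p1E, p2E) eqxx.
Qed.

(* A decidable family of finite sets D_l is given by [inD n l], meaning that n is
   in D_l; finiteness is normalized to D_l being bounded by l. *)
Definition freshly_reducible (T : Type) (theta theta' : nat -> T) : Prop :=
  forall inD : nat -> nat -> bool, computable2 (fun n l => inD n l : nat) ->
  (forall n l, inD n l -> n <= l) ->
  exists2 N : nat -> nat -> nat, computable2 N &
    forall i l, ~~ inD (N i l) l /\ theta' (N i l) = theta i.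

Lemma quasi_Godel_freshly_reducible (pr : nat -> nat -> nat) (A : set nat)
    (theta theta' : nat -> pfun1) :
  pairing pr -> quasi_Godel_numbering pr A theta ->
  quasi_Godel_numbering pr A theta' -> freshly_reducible theta theta'.
Proof.
move=> Hpr Htheta Htheta' inD CD D_le.
have [N CN NE] := self_referential_index Hpr Htheta Htheta' CD.
have Cpr : computable2 pr by case: Hpr.
have [m Cm mP] : exists2 m : 2.-tuple nat -> nat, computable m & forall v,
    ~~ inD (N (pr (tnth v ord0) (pr (tnth v ord_max) (m v)))) (tnth v ord_max).
  apply: (computable_search (b := fun c (v : 2.-tuple nat) =>
    ~~ inD (N (pr (tnth v ord0) (pr (tnth v ord_max) c))) (tnth v ord_max))).
    by solve_computable.
  move=> v; move: (tnth v ord0) (tnth v ord_max) => i l.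
  apply: contrapT => /forallNP allD.
  have ND c : inD (N (pr i (pr l c))) l by apply/negPn/negP/allD.
  have [c c' E|c] := @unbounded_of_injective (fun c => N (pr i (pr l c))) l.
    (* Equal indices number equal constant functions, which are compared at 0. *)
    have := NE i l c; have := NE i l c'; rewrite /= !ND E => ->.
    by move=> /(congr1 (@^~ 0)) [].
  by rewrite ltnNge (D_le _ _ (ND c)).
pose v2 i l : 2.-tuple nat := [tuple i; l].
exists (fun i l => N (pr i (pr l (m (v2 i l))))).
  have Cm' : computable2 (fun i l => m (v2 i l)).
    move: Cm; congr computable; apply/funext => v; congr m.
    by apply: eq_from_tnth; case=> [[|[|//]]] ?; rewrite !(tnth_nth 0).
  rewrite /computable2 /=; solve_computable.
  exact: Cm'.
move=> i l; have := mP (v2 i l); rewrite !(tnth_nth 0) /= => D.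
by split => //; rewrite NE (negbTE D).
Qed.

(** * Coded finite lists *)

(* Finite lists of naturals are coded by 0 for the empty list and (pr z l).+1
   for the list with head z and tail l; [code_drop p2 l m] removes the first m
   entries. *)
Definition code_drop (p2 : nat -> nat) (l m : nat) : nat :=
  nat_rec (fun=> nat) l (fun _ r => p2 r.-1) m.

(** A code is at least the length of its list, so it serves as the bound on positions; a remainder 0
    means that the list has ended. *)
Definition code_has (p1 p2 : nat -> nat) (P : nat -> bool) (l : nat) : bool :=
  has (fun m => (code_drop p2 l m != 0) && P (p1 (code_drop p2 l m).-1))
    (iota 0 l).

(** Since [p2 z <= z], a nonzero code strictly exceeds that of its tail. *)
Lemma code_drop_le pr p1 p2 l m :
  pairing pr -> unpairing pr p1 p2 -> code_drop p2 l m <= l - m.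
Proof.
move=> [_ _ pr_ge] [_ _ _ _ prE].
have p2_le z : p2 z <= z by have [_] := pr_ge (p1 z) (p2 z); rewrite prE.
elim: m => [|k IHk] /=; first by rewrite subn0.
by rewrite subnS (leq_trans (p2_le _)) // -!subn1 leq_sub2r.
Qed.

Lemma code_hasP pr p1 p2 (P : nat -> bool) l :
  pairing pr -> unpairing pr p1 p2 ->
  reflect (exists2 m, code_drop p2 l m != 0 & P (p1 (code_drop p2 l m).-1))
    (code_has p1 p2 P l).
Proof.
move=> Hpr Hup; apply: (iffP hasP).
  by move=> [m _ /andP[]]; exists m.
move=> [m nz Pm]; exists m; last by rewrite nz.
rewrite mem_iota add0n /= -subn_gt0; apply: leq_trans (code_drop_le l m Hpr Hup).
by rewrite lt0n.
Qed.

Lemma code_has_cons pr p1 p2 (P : nat -> bool) z l :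
  pairing pr -> unpairing pr p1 p2 ->
  code_has p1 p2 P (pr z l).+1 = P z || code_has p1 p2 P l.
Proof.
move=> Hpr Hup; have [_ _ p1E p2E _] := Hup.
have dropS m : code_drop p2 (pr z l).+1 m.+1 = code_drop p2 l m.
  by elim: m => [|m IHm]; rewrite /= ?p2E // -IHm.
apply/(code_hasP _ _ Hpr Hup)/orP => [[[|m]]|[Pz|]].
- by rewrite /= p1E; left.
- by rewrite dropS => nz Pm; right; apply/(code_hasP _ _ Hpr Hup); exists m.
- by exists 0; rewrite /= ?p1E.
- by move=> /(code_hasP _ _ Hpr Hup)[m nz Pm]; exists m.+1; rewrite dropS.
Qed.

(** Entries are bounded by the code, which gives the normalization that [freshly_reducible] demands
    of the finite sets. *)
Lemma code_has_le pr p1 p2 (P : nat -> bool) l :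
  pairing pr -> unpairing pr p1 p2 ->
  code_has p1 p2 P l -> exists2 z, z <= l & P z.
Proof.
move=> Hpr Hup /(code_hasP _ _ Hpr Hup)[m _ Pm]; eexists; last exact: Pm.
have [[_ _ pr_ge] [_ _ _ _ prE]] := (Hpr, Hup).
set d := code_drop p2 l m.
have [+ _] := pr_ge (p1 d.-1) (p2 d.-1); rewrite prE => /leq_trans; apply.
rewrite (leq_trans (leq_pred _)) // (leq_trans (code_drop_le l m Hpr Hup)) //.
exact: leq_subr.
Qed.

(** * The back-and-forth construction *)

(** Growing finite partial injections are coded as lists of pairs. Stage [s.+1] puts [s] into the
    domain and then into the range; the union over all stages is the graph of the bijection. *)
Lemma back_and_forth (pr : nat -> nat -> nat) (T : Type)
    (theta theta' : nat -> T) :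
  pairing pr -> freshly_reducible theta theta' ->
  freshly_reducible theta' theta ->
  exists g : nat -> nat,
    [/\ computable1 g, bijective g & forall i, theta i = theta' (g i)].
Proof.
move=> hpr fresh fresh'.
have [p1 [p2 Hup]] := unpairing_exists hpr.
have [Cp1 Cp2 p1E p2E prE] := Hup; have [Cpr _ pr_ge] := hpr.
have p1_le z : p1 z <= z by have [] := pr_ge (p1 z) (p2 z); rewrite prE.
have p2_le z : p2 z <= z by have [] := pr_ge (p1 z) (p2 z); rewrite prE.
pose dom i l := code_has p1 p2 (fun z => p1 z == i) l.
pose ran j l := code_has p1 p2 (fun z => p2 z == j) l.
pose mem i j l := code_has p1 p2 (fun z => z == pr i j) l.
have Cdom : computable2 (fun i l => dom i l : nat).
  by rewrite /computable2 /= /dom /code_has /code_drop; solve_computable.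
have Cran : computable2 (fun j l => ran j l : nat).
  by rewrite /computable2 /= /ran /code_has /code_drop; solve_computable.
have dom_le i l : dom i l -> i <= l.
  by move=> /(code_has_le hpr Hup)[z zl /eqP <-]; exact: leq_trans zl.
have ran_le j l : ran j l -> j <= l.
  by move=> /(code_has_le hpr Hup)[z zl /eqP <-]; exact: leq_trans zl.
have domP i l : dom i l <-> exists j, mem i j l.
  split=> [/(code_hasP _ _ hpr Hup)[m nz /eqP E]|[j]].
    exists (p2 (p1 (code_drop p2 l m).-1)); apply/(code_hasP _ _ hpr Hup).
    by exists m; rewrite // -E prE.
  move=> /(code_hasP _ _ hpr Hup)[m nz /eqP E].
  by apply/(code_hasP _ _ hpr Hup); exists m; rewrite // E p1E.
have ranP j l : ran j l <-> exists i, mem i j l.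
  split=> [/(code_hasP _ _ hpr Hup)[m nz /eqP E]|[i]].
    exists (p1 (p1 (code_drop p2 l m).-1)); apply/(code_hasP _ _ hpr Hup).
    by exists m; rewrite // -E prE.
  move=> /(code_hasP _ _ hpr Hup)[m nz /eqP E].
  by apply/(code_hasP _ _ hpr Hup); exists m; rewrite // E p2E.
have mem_cons i j a b l : mem i j (pr (pr a b) l).+1 <->
    (i = a /\ j = b) \/ mem i j l.
  rewrite /mem (code_has_cons _ _ _ hpr Hup).
  split=> [/orP[/eqP E|]|[[-> ->]|->]]; rewrite ?eqxx ?orbT //; last by right.
  by left; rewrite -(p1E i j) -{2}(p2E i j) -E p1E p2E.
(* [F i l] is a partner for [i] outside the range of [l], and [B j l] a partner for [j] outside its
   domain, so adding such a pair keeps the relation functional and injective. *)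
have [F CF FP] := fresh _ Cran ran_le.
have [B CB BP] := fresh' _ Cdom dom_le.
pose fwd i l := if dom i l then l else (pr (pr i (F i l)) l).+1.
pose bwd j l := if ran j l then l else (pr (pr (B j l) j) l).+1.
pose st s := nat_rec (fun=> nat) 0 (fun k l => bwd k (fwd k l)) s.
pose good l := [/\ forall i j j', mem i j l -> mem i j' l -> j = j',
  forall i i' j, mem i j l -> mem i' j l -> i = i' &
  forall i j, mem i j l -> theta i = theta' j].
have good_cons a b l : good l -> ~~ dom a l -> ~~ ran b l ->
    theta a = theta' b -> good (pr (pr a b) l).+1.
  move=> [fun_l inj_l eq_l] /negP/domP Na /negP/ranP Nb eab; split.
  - move=> i j j' /mem_cons[[-> ->]|ij] /mem_cons[[E1 E2]|ij'] //.
    + by case: Na; exists j'.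
    + by case: Na; exists j; rewrite -E1.
    + exact: fun_l ij ij'.
  - move=> i i' j /mem_cons[[-> ->]|ij] /mem_cons[[E1 E2]|ij'] //.
    + by case: Nb; exists i'.
    + by case: Nb; exists i; rewrite -E2.
    + exact: inj_l ij ij'.
  - by move=> i j /mem_cons[[-> ->]|/eq_l].
have good_fwd i l : good l -> good (fwd i l).
  rewrite /fwd; case: ifP => // /negbT Ni gl.
  by have [NF EF] := FP i l; exact: good_cons.
have good_bwd j l : good l -> good (bwd j l).
  rewrite /bwd; case: ifP => // /negbT Nj gl.
  by have [NB EB] := BP j l; exact: good_cons.
have good_st s : good (st s).
  by elim: s => [//|s IHs]; exact/good_bwd/good_fwd.
have mem_fwd i j k l : mem i j l -> mem i j (fwd k l).
  by rewrite /fwd; case: ifP => // _ ij; apply/mem_cons; right.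
have mem_bwd i j k l : mem i j l -> mem i j (bwd k l).
  by rewrite /bwd; case: ifP => // _ ij; apply/mem_cons; right.
have mem_st i j s t : s <= t -> mem i j (st s) -> mem i j (st t).
  move=> /subnKC <-; elim: (t - s) => [|k IHk]; first by rewrite addn0.
  by rewrite addnS => /IHk ?; apply/mem_bwd/mem_fwd.
(* The step from [st i] to [st i.+1] treats [i] on both sides, which fixes the stage at which a
   partner can be looked up. *)
have st_dom i : exists j, mem i j (st i.+1).
  suff [j ij] : exists j, mem i j (fwd i (st i)) by exists j; exact: mem_bwd.
  rewrite /fwd; case: ifP => [/domP//|_].
  by exists (F i (st i)); apply/mem_cons; left.
have st_ran j : exists i, mem i j (st j.+1).
  rewrite [st _]/= /bwd; set l := fwd j _; case: ifP => [/ranP//|_].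
  by exists (B j l); apply/mem_cons; left.
have Cst : computable1 st.
  have Cfwd : computable2 fwd by rewrite /computable2 /= /fwd; solve_computable.
  have Cbwd : computable2 bwd by rewrite /computable2 /= /bwd; solve_computable.
  by rewrite /computable1 /= /st; solve_computable.
have [g Cg gP] : exists2 g : 1.-tuple nat -> nat, computable g &
    forall v, mem (thead v) (g v) (st (thead v).+1).
  apply: (computable_search (b := fun j (v : 1.-tuple nat) =>
    mem (thead v) j (st (thead v).+1))) => //.
  by rewrite /mem /code_has /code_drop; solve_computable.
have [h hP] := choice st_ran.
pose G i := g [tuple i].
have GP i : mem i (G i) (st i.+1) by have := gP [tuple i]; rewrite theadE.
(* Pairs from different stages are compared at the later one, where the invariant [good] applies. *)
have same s t i j i' j' : mem i j (st s) -> mem i' j' (st t) -> i = i' <-> j = j'.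
  move=> /(mem_st _ _ _ _ (leq_maxl s t)) ij /(mem_st _ _ _ _ (leq_maxr s t)) ij'.
  have [fun_l inj_l _] := good_st (maxn s t).
  by split=> E; subst; [exact: fun_l ij ij' | exact: inj_l ij ij'].
exists G; split.
- move: Cg; congr computable; apply/funext => v; congr g.
  by apply: eq_from_tnth => i; rewrite (ord1 i).
- exists h => [i|j]; first exact/(same _ _ _ _ _ _ (hP (G i)) (GP i)).
  exact/(same _ _ _ _ _ _ (GP (h j)) (hP j)).
- by move=> i; have [_ _] := good_st i.+1; apply.
Qed.

Theorem theorem8p4 (pr : nat -> nat -> nat) (hpr : pairing pr)
    (A : set nat) (hAinf : infinite_set A) (hAce : computably_enumerable A)
    (theta theta' : nat -> pfun1)
    (htheta : quasi_Godel_numbering pr A theta)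
    (htheta' : quasi_Godel_numbering pr A theta') :
  exists g : nat -> nat,
    [/\ computable1 g, bijective g & forall i, theta i = theta' (g i)].
Proof.
apply: (back_and_forth hpr).
  exact: quasi_Godel_freshly_reducible hpr htheta htheta'.
exact: quasi_Godel_freshly_reducible hpr htheta' htheta.
Qed.
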